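(* Let $N$ be a positive integer and let $c_{ij}$ ($1\le i\le I$, $1\le j\le J$) be given conditional frequencies, written as $c_{ij}=\frac{g_{ij}}{h_{ij}}$ with $g_{ij}\ge 0$, $h_{ij}\geq 1$ relatively prime integers, and $\sum_{i=1}^I c_{ij}=1$ for every $j$. For each $j$ let $m_j$ be the least common multiple of $h_{1j},\dots,h_{Ij}$. Then the positive integer solutions $(x_1,\dots,x_J)$ of $$\sum_{j=1}^{J} m_j x_j = N$$ correspond one-to-one to the $B$-marginals $(s_{+1+},\dots,s_{+J+})$ of the tables in $\mathcal F_{A|B}$, the correspondence being given by the scaling $s_{+j+}=m_j x_j$ for $1\le j\le J$. In particular, a table consistent with the given information $\{c_{ij},N\}$ exists (i.e. $\mathcal F_{A|B}\neq\emptyset$) if and only if the equation $\sum_{j=1}^{J} m_j x_j = N$ has a solution in positive integers.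
   Context: Let $X_1,\dots,X_r$ be categorical variables with finitely many levels each. Let $A,B$ be disjoint proper subsets of $\{X_1,\dots,X_r\}$ and let $C$ be the set of the remaining variables (possibly empty). Regard $A,B,C$ as three compound categorical variables with $I$, $J$, $K$ levels respectively ($K=1$ if $C=\emptyset$). An $r$-way contingency table (an array of nonnegative integer counts) is thereby identified with a 3-way array $(s_{ijk})$ of nonnegative integers, $1\le i\le I$, $1\le j\le J$, $1\le k\le K$. A subscript $+$ denotes summation over that index: $s_{ij+}=\sum_k s_{ijk}$, $s_{+j+}=\sum_{i,k}s_{ijk}$. The observed conditional frequencies $c_{ij}=P(A=i\mid B=j)$ are exact (no rounding). The fiber $\mathcal F_{A|B}$ is the set of all tables $(s_{ijk})$ of nonnegative integers such that $\sum_{i,j,k}s_{ijk}=N$, every $B$-marginal is positive ($s_{+j+}>0$ for all $j$), and $s_{ij+}/s_{+j+}=c_{ij}$ for all $i,j$. Such a table is called consistent with $\{c_{ij},N\}$. *)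

(* Defs.v *)
From mathcomp Require Import all_boot all_order all_algebra.
From mathcomp Require Import classical_sets functions.

Set Implicit Arguments.
Unset Strict Implicit.
Unset Printing Implicit Defensive.

Import GRing.Theory.
Local Open Scope classical_set_scope.

(* An r-way table, with the variables grouped into compound variables A, B, C
   having I, J, K levels; all indices are shifted to start at 0. *)
Definition table (I J K : nat) := {ffun 'I_I * 'I_J * 'I_K -> nat}.

Section Marginals.
Variables (I J K : nat).
Implicit Types s : table I J K.

Definition AB_marginal s (i : 'I_I) (j : 'I_J) : nat :=
  \sum_(k < K) s (i, j, k).

Definition B_marginal s : {ffun 'I_J -> nat} :=
  [ffun j => \sum_(i < I) \sum_(k < K) s (i, j, k)].

Definition fiber (N : nat) (c : 'I_I -> 'I_J -> rat) : set (table I J K) :=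
  [set s : table I J K | [/\ \sum_(i < I) \sum_(j < J) \sum_(k < K) s (i, j, k) = N,
               forall j, 0 < B_marginal s j
             & forall i j, ((AB_marginal s i j)%:R / (B_marginal s j)%:R
                            = c i j)%R ]].

End Marginals.

Definition col_lcm (I J : nat) (h : 'I_I -> 'I_J -> nat) (j : 'I_J) : nat :=
  \big[lcmn/1]_(i < I) h i j.

Definition positive_solutions (J : nat) (m : 'I_J -> nat) (N : nat) :
    set {ffun 'I_J -> nat} :=
  [set x : {ffun 'I_J -> nat} | (forall j, 0 < x j) /\ \sum_(j < J) m j * x j = N].

Definition scaling (J : nat) (m : 'I_J -> nat) (x : {ffun 'I_J -> nat}) :
    {ffun 'I_J -> nat} :=
  [ffun j => m j * x j].

(* Main.v *)
Require Import Defs.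
From mathcomp Require Import all_boot all_order all_algebra.
From mathcomp Require Import classical_sets functions.

(** A table has conditional frequencies [g / h] exactly when its marginals
    satisfy the cross-multiplied identity [AB * h = g * B].  Since [g] and [h]
    are coprime, [h i j] then divides the [j]-th B-marginal for every [i], so
    this marginal is a multiple of the least common multiple [m j]
    ([col_lcm_dvd_B_marginal]); the cofactors are the solution [x].

    Conversely, given [x], the number [g i j * (m j / h i j) * x j] is a natural
    number equal to [c i j * (m j * x j)], and because each column of [c] sums
    to 1 these numbers add up to [m j * x j] over [i].  Putting all of them in
    the first level of [C] yields a consistent table with B-marginal
    [m j * x j] ([scaled_table_fiber], [B_marginal_scaled_table]).  Injectivity
    of the scaling is just positivity of the [m j]. *)

Set Implicit Arguments.
Unset Strict Implicit.
Unset Printing Implicit Defensive.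

Import GRing.Theory.
Local Open Scope classical_set_scope.

Lemma eq_natr_div (a b c d : nat) : 0 < b -> 0 < d ->
  (a%:R / b%:R = c%:R / d%:R :> rat)%R <-> a * d = c * b.
Proof.
move=> b_gt0 d_gt0.
have b0 : (b%:R != 0 :> rat)%R by rewrite Num.Theory.pnatr_eq0 -lt0n.
have d0 : (d%:R != 0 :> rat)%R by rewrite Num.Theory.pnatr_eq0 -lt0n.
have E : (a%:R / b%:R == c%:R / d%:R :> rat)%R = (a * d == c * b).
  by rewrite eqr_div // -!natrM Num.Theory.eqr_nat.
by split=> /eqP; [rewrite E | rewrite -E] => /eqP.
Qed.

Lemma dvdn_col_lcm I J (h : 'I_I -> 'I_J -> nat) i j : h i j %| col_lcm h j.
Proof. exact: (@biglcmn_sup _ i). Qed.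

Lemma col_lcm_gt0 I J (h : 'I_I -> 'I_J -> nat) j :
  (forall i, 0 < h i j) -> 0 < col_lcm h j.
Proof.
move=> h_gt0; rewrite /col_lcm; elim/big_ind: _ => // m n m0 n0.
by rewrite lcmn_gt0 m0.
Qed.

Lemma B_marginalE I J K (s : table I J K) j :
  B_marginal s j = \sum_(i < I) AB_marginal s i j.
Proof. by rewrite ffunE. Qed.

Lemma sum_B_marginal I J K (s : table I J K) :
  \sum_(j < J) B_marginal s j =
  \sum_(i < I) \sum_(j < J) \sum_(k < K) s (i, j, k).
Proof. by rewrite [RHS]exchange_big; apply: eq_bigr => j _; rewrite ffunE. Qed.

(** From [AB * h = g * B], each [h i j] divides [g i j * B], hence [B] by Gauss's
    lemma. *)
Lemma col_lcm_dvd_B_marginal I J K N (c : 'I_I -> 'I_J -> rat)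
    (g h : 'I_I -> 'I_J -> nat) (s : table I J K) j :
  (forall i, 0 < h i j) -> (forall i, coprime (g i j) (h i j)) ->
  (forall i, c i j = ((g i j)%:R / (h i j)%:R)%R) ->
  fiber N c s -> col_lcm h j %| B_marginal s j.
Proof.
move=> h_gt0 gh cE [_ B_gt0 sc]; apply/dvdn_biglcmP => i _.
have /eq_natr_div E := etrans (sc i j) (cE i).
by rewrite -(@Gauss_dvdr _ (g i j)) 1?coprime_sym // -E // dvdn_mull.
Qed.

(** Consistency only constrains the sums over [k], so a single level of [C] can
    carry all the counts; the level 0 exists as soon as [0 < K]. *)
Definition scaled_table I J K (g h : 'I_I -> 'I_J -> nat)
    (x : {ffun 'I_J -> nat}) : table I J K :=
  [ffun t : 'I_I * 'I_J * 'I_K => let: (i, j, k) := t in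
     if k == 0 :> nat then g i j * (col_lcm h j %/ h i j) * x j else 0].

Lemma AB_marginal_scaled_table I J K (g h : 'I_I -> 'I_J -> nat) x i j :
  0 < K ->
  AB_marginal (scaled_table K g h x) i j =
  g i j * (col_lcm h j %/ h i j) * x j.
Proof.
case: K => // K _; rewrite /AB_marginal big_ord_recl ffunE /= big1 ?addn0 //.
by move=> k _; rewrite ffunE.
Qed.

(** This is [m * \sum_i g i / h i = m], read in the natural numbers: since
    [h i] divides [m], the quotient [m %/ h i] is exact. *)
Lemma sum_scaled_numerators (I m : nat) (g h : 'I_I -> nat) :
  (forall i, 0 < h i) -> (forall i, h i %| m) ->
  (\sum_(i < I) (g i)%:R / (h i)%:R = 1 :> rat)%R ->
  \sum_(i < I) g i * (m %/ h i) = m.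
Proof.
move=> h_gt0 hm sum1; apply/eqP; rewrite -(Num.Theory.eqr_nat rat) natr_sum.
rewrite -[eqbRHS]mulr1 -[X in (_ * X)%R]sum1 mulr_sumr.
apply/eqP/eq_bigr => i _.
have h0 : ((h i)%:R != 0 :> rat)%R by rewrite Num.Theory.pnatr_eq0 -lt0n.
by rewrite -[in RHS](divnK (hm i)) !natrM mulrACA divff // mulr1 mulrC.
Qed.

Lemma B_marginal_scaled_table I J K (g h : 'I_I -> 'I_J -> nat) x :
  0 < K -> (forall i j, 0 < h i j) ->
  (forall j, \sum_(i < I) (g i j)%:R / (h i j)%:R = 1 :> rat)%R ->
  B_marginal (scaled_table K g h x) = scaling (col_lcm h) x.
Proof.
move=> K_gt0 h_gt0 sum1; apply/ffunP => j; rewrite B_marginalE ffunE.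
under eq_bigr do rewrite AB_marginal_scaled_table //.
rewrite -big_distrl /= (@sum_scaled_numerators _ _ (g^~ j) (h^~ j)) // => i.
exact: dvdn_col_lcm.
Qed.

Lemma scaled_table_fiber I J K N (c : 'I_I -> 'I_J -> rat)
    (g h : 'I_I -> 'I_J -> nat) x :
  0 < K -> (forall i j, 0 < h i j) ->
  (forall i j, c i j = ((g i j)%:R / (h i j)%:R)%R) ->
  (forall j, (\sum_(i < I) c i j = 1)%R) ->
  positive_solutions (col_lcm h) N x -> fiber N c (scaled_table K g h x).
Proof.
move=> K_gt0 h_gt0 cE c1 [x_gt0 xN].
have BE : B_marginal (scaled_table K g h x) = scaling (col_lcm h) x.
  by apply: B_marginal_scaled_table => // j; under eq_bigr do rewrite -cE.
have B_gt0 j : 0 < B_marginal (scaled_table K g h x) j.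
  by rewrite BE ffunE muln_gt0 col_lcm_gt0 ?x_gt0.
split=> //.
- by rewrite -sum_B_marginal BE -xN; apply: eq_bigr => j _; rewrite ffunE.
- move=> i j; rewrite cE; apply/eq_natr_div => //.
  rewrite AB_marginal_scaled_table // BE ffunE -!mulnA (mulnC (x j)).
  by rewrite (mulnA (_ %/ _)) divnK // dvdn_col_lcm.
Qed.

Lemma scaling_inj J (m : 'I_J -> nat) :
  (forall j, 0 < m j) -> injective (scaling m).
Proof.
move=> m_gt0 x y /ffunP xy; apply/ffunP => j.
by move: (xy j); rewrite !ffunE => /eqP; rewrite eqn_pmul2l // => /eqP.
Qed.

Lemma fiber_B_marginal_scaling I J K N (c : 'I_I -> 'I_J -> rat)
    (g h : 'I_I -> 'I_J -> nat) (s : table I J K) :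
  (forall i j, 0 < h i j) -> (forall i j, coprime (g i j) (h i j)) ->
  (forall i j, c i j = ((g i j)%:R / (h i j)%:R)%R) -> fiber N c s ->
  exists2 x, positive_solutions (col_lcm h) N x
           & scaling (col_lcm h) x = B_marginal s.
Proof.
move=> h_gt0 gh cE sF.
have mB j : col_lcm h j %| B_marginal s j.
  by apply: (col_lcm_dvd_B_marginal _ _ _ sF).
have [sN B_gt0 _] := sF.
pose x := [ffun j => B_marginal s j %/ col_lcm h j].
have xE j : col_lcm h j * x j = B_marginal s j by rewrite ffunE mulnC divnK.
exists x; last by apply/ffunP => j; rewrite [LHS]ffunE xE.
split=> [j|]; last by under eq_bigr do rewrite xE; rewrite sum_B_marginal.
by have := B_gt0 j; rewrite -xE muln_gt0 => /andP[].
Qed.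

Theorem theorem2p1 (I J K N : nat)
    (c : 'I_I -> 'I_J -> rat) (g h : 'I_I -> 'I_J -> nat)
    (I_gt0 : 0 < I) (J_gt0 : 0 < J) (K_gt0 : 0 < K) (N_gt0 : 0 < N)
    (h_gt0 : forall i j, 0 < h i j)
    (gh_coprime : forall i j, coprime (g i j) (h i j))
    (cE : forall i j, c i j = ((g i j)%:R / (h i j)%:R)%R)
    (c_sum1 : forall j, (\sum_(i < I) c i j = 1)%R) :
  set_bij (positive_solutions (col_lcm h) N)
          (@B_marginal I J K @` fiber N c)
          (scaling (col_lcm h))
  /\ (@fiber I J K N c !=set0 <-> positive_solutions (col_lcm h) N !=set0).
Proof.
have toF x : positive_solutions (col_lcm h) N x ->
    fiber N c (scaled_table K g h x) by exact: scaled_table_fiber.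
have ofF (s : table I J K) (sF : fiber N c s) :=
  fiber_B_marginal_scaling h_gt0 gh_coprime cE sF.
split; last first.
  split=> [[s /ofF[x xS _]]|[x /toF xF]]; first by exists x.
  by exists (scaled_table K g h x).
split.
- move=> x xS; exists (scaled_table K g h x); first exact: toF.
  by apply: B_marginal_scaled_table => // j; under eq_bigr do rewrite -cE.
- by move=> x y _ _; apply: scaling_inj => j; apply: col_lcm_gt0.
- by move=> _ [s /ofF[x xS xE] <-]; exists x.
Qed.
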